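(* Let $\Gamma$ be a finite simple graph, and let $P$ be a locally finite poset equipped with a surjective coloring function $\kappa:P\to\Gamma$. The following are equivalent: (i) The lattice $\mathcal{FI}(P)$ carries an $X$-square nilpotent representation of $\mathfrak{n}_+$. (ii) The lattice $\mathcal{FI}(P)$ carries an $X$-square nilpotent representation of $\mathfrak{b}'_+$. (iii) The properties EC, NA, and I3ND are satisfied by $P$. (iv) The lattice $\mathcal{FI}(P)$ carries a $Y$-square nilpotent representation of $\mathfrak{b}'_-$. (v) The lattice $\mathcal{FI}(P)$ carries a $Y$-square nilpotent representation of $\mathfrak{n}_-$. Any operators $\{H_a\}_{a\in\Gamma}$ used to satisfy Part (ii) or Part (iv) are edge diagonal operators.
   Context: Graph and poset. $\Gamma$ has no loops or multiple edges; its vertex set is also denoted $\Gamma$ and its vertices are called colors. For $a,b\in\Gamma$, $a\sim b$ means $\{a,b\}$ is an edge (adjacent); $a,b$ are distant if $a\ne b$ and $\{a,b\}$ is not an edge. Put $\theta_{ab}=2$ if $a=b$, $\theta_{ab}=-1$ if $a\sim b$, $\theta_{ab}=0$ if $a,b$ are distant. Locally finite means every closed interval of $P$ is finite. $x\to y$ means $x$ is covered by $y$; $x,y$ are neighbors if $x\to y$ or $y\to x$. A filter is an upwardly closed subset, an ideal a downwardly closed subset. A split is a pair $(F,I)$ with $F$ a filter and $I=P-F$; $\mathcal{FI}(P)$ is the set of all splits, ordered by inclusion of ideals. Write $(F-x,I+x)$ for $(F\setminus\{x\},I\cup\{x\})$ and $(F+y,I-y)$ for $(F\cup\{y\},I\setminus\{y\})$.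 Operators. $V=\langle\mathcal{FI}(P)\rangle$ is the free complex vector space with basis $\{\langle F,I\rangle\}_{(F,I)\in\mathcal{FI}(P)}$. For $a\in\Gamma$ define linearly $X_a.\langle F,I\rangle=\sum\langle F-x,I+x\rangle$, summed over the elements $x$ of color $a$ minimal in $F$, and $Y_a.\langle F,I\rangle=\sum\langle F+y,I-y\rangle$, summed over the elements $y$ of color $a$ maximal in $I$. Any assertion about these operators is understood to include that the defining sums are finite, so that the operators are well defined. (Finiteness is automatic when EC holds.) $X$-square (respectively $Y$-square) nilpotent means $X_a^2=0$ (respectively $Y_a^2=0$) for all $a$. Lie algebras. Relations: XX: $[x_b,x_a]=0$ for $a,b$ distant, and $[x_a,[x_a,x_b]]=0$ for all $a,b$; YY: the same with $y$ in place of $x$; HH: $[h_b,h_a]=0$; HX: $[h_b,x_a]=\theta_{ab}x_a$; HY: $[h_b,y_a]=-\theta_{ab}y_a$. The complex Lie algebras $\mathfrak{n}_+$, $\mathfrak{n}_-$, $\mathfrak{b}'_+$, $\mathfrak{b}'_-$ are generated respectively by $\{x_a\}$ subject to XX; $\{y_a\}$ subject to YY; $\{x_a,h_a\}$ subject to XX, HH, HX; $\{y_a,h_a\}$ subject to YY, HH, HY. Representations. $\mathcal{FI}(P)$ carries a representation of one of these algebras if there are operators on $V$ for its generators, with $X_a$ for $x_a$, $Y_a$ for $y_a$, and operators $H_a$ for $h_a$ diagonal in the basis $\{\langle F,I\rangle\}$, satisfying the defining relations with respect to the commutator on $\mathrm{End}(V)$. Edge diagonal operators. Diagonal operators $\{H_a\}_{a\in\Gamma}$,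 $H_a.\langle F,I\rangle=\eta_a(F,I)\langle F,I\rangle$ with $\eta_a:\mathcal{FI}(P)\to\mathbb{C}$, are edge diagonal operators if $\eta_b(F-x,I+x)-\eta_b(F,I)=\theta_{\kappa(x),b}$ for every $b\in\Gamma$, every split $(F,I)$, and every minimal element $x$ of $F$. Coloring properties. EC: elements with equal colors are comparable. NA: neighbors have adjacent colors. I3ND: if three successive neighbors $x\to y\to z$ form an interval in $P$ (i.e. $[x,z]=\{x,y,z\}$), then $x$ and $z$ have different colors. *)

(* Defs.v *)
From HB Require Import structures.
From mathcomp Require Import all_boot all_order all_algebra.
From mathcomp Require Import complex.
From mathcomp Require Import mathcomp_extra boolp classical_sets cardinality fsbigop reals.
From mathcomp.multinomials Require Import freeg.

Set Implicit Arguments.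
Unset Strict Implicit.
Unset Printing Implicit Defensive.

Import Order.TTheory GRing.Theory Num.Theory.
Local Open Scope classical_set_scope.
Local Open Scope ring_scope.

Section Poset.
Context (d : Order.disp_t) (P : porderType d).
Implicit Types (x y z : P) (F I : set P).

Definition locally_finite := forall x y, finite_set [set z | (x <= z <= y)%O].

Definition covers x y := (x < y)%O /\ ~ exists z, (x < z < y)%O.

Definition neighbors x y := covers x y \/ covers y x.

Definition is_filter F := forall x y, (x <= y)%O -> F x -> F y.

Definition minimal_in F x := F x /\ ~ exists2 y, F y & (y < x)%O.

Definition maximal_in I y := I y /\ ~ exists2 x, I x & (y < x)%O.

Definition is_split (s : set P * set P) : bool :=
  `[< is_filter s.1 /\ s.2 = ~` s.1 >].

Record split := Split { split_pair :> set P * set P; splitP : is_split split_pair }.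

HB.instance Definition _ := [isSub for split_pair].
HB.instance Definition _ := [Choice of split by <:].

Definition filt (s : split) : set P := s.1.
Definition ideal (s : split) : set P := s.2.

(* [insubd s] returns the default [s] on pairs that are not splits; these are *)
(* only used at minimal elements of the filter (resp. maximal elements of the *)
(* ideal), where the pair is a split by [to_idealE] (resp. [to_filtE]).       *)
Definition to_ideal (s : split) x : split :=
  insubd s (filt s `\ x, ideal s `|` [set x]).

Definition to_filt (s : split) y : split :=
  insubd s (filt s `|` [set y], ideal s `\ y).

Lemma to_idealE (s : split) x : minimal_in (filt s) x ->
  to_ideal s x = (filt s `\ x, ideal s `|` [set x]) :> set P * set P.
Proof.
move=> [Fx minx]; rewrite /to_ideal; apply: insubdK.
have /asboolP[Fs Is] := splitP s; apply/asboolP; split => /=.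
- move=> y z yz [Fy yx]; split; first exact: Fs yz Fy.
  move=> zx; rewrite /= in zx yx; rewrite {}zx in yz.
  apply: minx; exists y => //; rewrite lt_neqAle yz andbT; exact/eqP.
- by rewrite /ideal Is /filt setDE setCI setCK.
Qed.

Lemma to_filtE (s : split) y : maximal_in (ideal s) y ->
  to_filt s y = (filt s `|` [set y], ideal s `\ y) :> set P * set P.
Proof.
move=> [Iy maxy]; rewrite /to_filt; apply: insubdK.
have /asboolP[Fs Is] := splitP s; apply/asboolP; split => /=.
- move=> u z uz [Fu|/= uy]; first by left; exact: Fs uz Fu.
  rewrite {}uy in uz.
  have [->|zy] := eqVneq z y; first by right.
  left; apply: contrapT => Fz; apply: maxy; exists z; first by rewrite /ideal Is.
  by rewrite lt_neqAle uz andbT eq_sym.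
- by rewrite /ideal Is /filt setDE setCU.
Qed.

End Poset.

Section ColoredPoset.
Context (Gamma : finType) (adj : rel Gamma).
Context (d : Order.disp_t) (P : porderType d) (kappa : P -> Gamma).

Definition distant (a b : Gamma) := (a != b) && ~~ adj a b.

Definition theta (a b : Gamma) : int :=
  if a == b then 2 else if adj a b then -1 else 0.

Definition EC := forall x y : P, kappa x = kappa y -> (x <= y)%O \/ (y <= x)%O.

Definition NA := forall x y : P, neighbors x y -> adj (kappa x) (kappa y).

Definition I3ND := forall x y z : P, covers x y -> covers y z ->
  [set w | (x <= w <= z)%O] = [set x; y; z] -> kappa x <> kappa z.

End ColoredPoset.

Section LieRelations.
Context (Gamma : finType) (adj : rel Gamma).
Context (K : comNzRingType) (V : lmodType K).
Implicit Types (f g : V -> V) (x y h : Gamma -> V -> V).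

Definition commutator f g : V -> V := fun v => f (g v) - g (f v).

(* Stated for arbitrary generators [x]: taken at [y] this is relation YY. *)
Definition rel_XX x :=
  (forall a b, distant adj a b -> commutator (x b) (x a) =1 fun=> 0) /\
  (forall a b, commutator (x a) (commutator (x a) (x b)) =1 fun=> 0).

Definition rel_HH h := forall a b, commutator (h b) (h a) =1 fun=> 0.

Definition rel_HX h x := forall a b v,
  commutator (h b) (x a) v = (theta adj a b)%:~R *: x a v.

Definition rel_HY h y := forall a b v,
  commutator (h b) (y a) v = - (theta adj a b)%:~R *: y a v.

Definition square_nilpotent x := forall a v, x a (x a v) = 0.

End LieRelations.

Lemma fglift_linear (K : nzRingType) (T : choiceType) (M : lmodType K)
    (f : T -> M) : linear (fglift f : {freeg T / K} -> M).
Proof.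
have fB := lift_is_additive f; have f0 : fglift f 0 = 0.
  by rewrite -(subrr 0) fB subrr.
have fN u : fglift f (- u) = - fglift f u by rewrite -sub0r fB f0 sub0r.
have fD u v : fglift f (u + v) = fglift f u + fglift f v.
  by rewrite -{1}(opprK v) fB fN opprK.
have fS (I : Type) (r : seq I) (g : I -> {freeg T / K}) :
    fglift f (\sum_(i <- r) g i) = \sum_(i <- r) fglift f (g i).
  by elim: r => [|i r IHr]; rewrite ?(big_nil, big_cons) ?f0 // fD IHr.
move=> c u v; rewrite fD; congr (_ + _).
rewrite -[u in RHS]freeg_sumE fS scaler_sumr [c *: u]/(fgscale c u) fS.
by apply: eq_bigr => x _; rewrite !liftU scalerA.
Qed.

Section Operators.
Context (R : realType).
Context (Gamma : finType) (adj : rel Gamma).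
Context (d : Order.disp_t) (P : porderType d) (kappa : P -> Gamma).

Definition FIspace : lmodType R[i] := {freeg (split P) / R[i]}.

Definition ket (s : split P) : FIspace := << s >>.

Definition X_index (a : Gamma) (s : split P) : set P :=
  [set x | kappa x = a /\ minimal_in (filt s) x].

Definition Y_index (a : Gamma) (s : split P) : set P :=
  [set y | kappa y = a /\ maximal_in (ideal s) y].

(* [\sum_(x \in A)] is 0 when [A] is infinite, so these operators have their  *)
(* meaning only under [X_finite] (resp. [Y_finite]).                          *)
Definition Xop (a : Gamma) : FIspace -> FIspace :=
  fglift (fun s => \sum_(x \in X_index a s) ket (to_ideal s x)).

Definition Yop (a : Gamma) : FIspace -> FIspace :=
  fglift (fun s => \sum_(y \in Y_index a s) ket (to_filt s y)).

Fact Xop_linear a : linear (Xop a).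
Proof. exact: fglift_linear. Qed.

Fact Yop_linear a : linear (Yop a).
Proof. exact: fglift_linear. Qed.

HB.instance Definition _ a :=
  GRing.isLinear.Build R[i] FIspace FIspace _ (Xop a) (Xop_linear a).
HB.instance Definition _ a :=
  GRing.isLinear.Build R[i] FIspace FIspace _ (Yop a) (Yop_linear a).

Lemma Xop_ket a s :
  Xop a (ket s) = \sum_(x \in X_index a s) ket (to_ideal s x).
Proof. by rewrite /Xop liftU scale1r. Qed.

Lemma Yop_ket a s :
  Yop a (ket s) = \sum_(y \in Y_index a s) ket (to_filt s y).
Proof. by rewrite /Yop liftU scale1r. Qed.

Definition X_finite := forall a s, finite_set (X_index a s).
Definition Y_finite := forall a s, finite_set (Y_index a s).

Definition diagonal_with (h : Gamma -> FIspace -> FIspace)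
    (eta : Gamma -> split P -> R[i]) :=
  forall a s, h a (ket s) = eta a s *: ket s.

Definition diagonal h := exists eta, diagonal_with h eta.

Definition edge_diagonal (h : Gamma -> FIspace -> FIspace) :=
  exists2 eta, diagonal_with h eta &
    forall b s x, minimal_in (filt s) x ->
      eta b (to_ideal s x) - eta b s = (theta adj (kappa x) b)%:~R.

Definition rep_n_plus := X_finite /\ rel_XX adj Xop.

Definition rep_n_minus := Y_finite /\ rel_XX adj Yop.

Definition rep_b_plus (h : Gamma -> {linear FIspace -> FIspace}) :=
  [/\ X_finite, diagonal h, rel_XX adj Xop, rel_HH h & rel_HX adj h Xop].

Definition rep_b_minus (h : Gamma -> {linear FIspace -> FIspace}) :=
  [/\ Y_finite, diagonal h, rel_XX adj Yop, rel_HH h & rel_HY adj h Yop].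

End Operators.

Arguments Xop R {Gamma d P} kappa a _.
Arguments Yop R {Gamma d P} kappa a _.

(* Main.v *)
From HB Require Import structures.
From mathcomp Require Import all_boot all_order all_algebra.
From mathcomp Require Import complex reals.
From mathcomp Require Import boolp classical_sets cardinality fsbigop finmap.
From mathcomp.multinomials Require Import freeg.
Require Import Defs.

Set Implicit Arguments.
Unset Strict Implicit.
Unset Printing Implicit Defensive.

Import Order.TTheory GRing.Theory Num.Theory.
Local Open Scope classical_set_scope.
Local Open Scope ring_scope.

(** Both families of operators are instances of one process. A split is
    determined by its filter, and X_a peels a minimal element of color a off
    that filter; dually a split is determined by its ideal, which is a filter
    of the opposite poset, and Y_a peels a minimal element (for the opposite
    order) off it. So everything is proved once, for a type of states in
    bijection with the filters of a poset ([peeling]); since EC, NA and I3ND are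
    invariant under reversing the order, both halves of the equivalence meet at
    the coloring properties.

    Relations force the coloring properties ([peel_rep_coloring], left to
    right). A square applied to a basis vector is a sum of basis vectors with
    nonnegative coefficients, so it vanishes only if no two elements of the
    same color can be peeled in succession. The filter generated by two
    incomparable elements of the same color would allow this, whence EC. From
    then on a peeling operator sends a basis vector to a basis vector or to
    zero. In the principal filter of x only x is minimal, and if x is covered
    by y then y can be peeled after x but not before. Thus colors of neighbors
    are distinct (square zero) and not distant (commutation), whence NA. Modulo
    squares the Serre relation says that X_a X_b X_a vanishes, and a
    three-element interval with ends of the same color, peeled off the principal
    filter of its bottom, would contradict that.

    Coloring properties force the relations. An element that becomes minimal
    only once x has been removed covers x ([minimal_setD1E]); with NA this
    gives square-nilpotency and lets distant colors commute. If x, y, z with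
    x and z of the same color can be peeled in this order, EC puts x below z, NA
    forces an element strictly between them, and only y can be one, so I3ND is
    violated ([active_sandwich]); hence X_a X_b X_a = 0, which is the Serre relation.

    For diagonal operators, the relation with X_a compares eigenvalues along one
    peeling step, so it holds exactly when the eigenvalues jump by the
    prescribed weight ([diagonal_commutatorP]). Such eigenvalues always exist:
    a filter is compared with a reference filter differing from it by finitely
    many elements, and the weights of the difference are summed
    ([potential_exists]). *)

(** * Linear maps on a free module *)

Section FreeModule.
Context (K : comNzRingType) (S : choiceType).

Lemma fglift_basis (M : lmodType K) (f : S -> M) s :
  fglift f (<< s >> : {freeg S / K}) = f s.
Proof. by rewrite liftU scale1r. Qed.

Lemma eq_on_basis (M : lmodType K) (f g : {linear {freeg S / K} -> M}) :
  (forall s, f << s >> = g << s >>) -> f =1 g.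
Proof.
move=> fg; elim/freeg_ind_dom0 => [|k s v _ _ IH]; first by rewrite !linear0.
have -> : << k *g s >> = k *: << s >> :> {freeg S / K}.
  by apply/eqP/freeg_eqP => t; rewrite coeff_fgscale !coeffU mul1r.
by rewrite !linearD !linearZ IH fg.
Qed.

End FreeModule.

(** * Minimal elements of filters *)

Section PosetMinimal.
Context (d : Order.disp_t) (P : porderType d).
Implicit Types (x y z : P).

Definition upset x : set P := [set z | (x <= z)%O].

Lemma upset_filter x : is_filter (upset x).
Proof. by move=> y z yz xy; exact: le_trans xy yz. Qed.

Lemma minimal_upset x : minimal_in (upset x) x.
Proof.
by split=> [|[y xy /(le_lt_trans xy)]]; rewrite /upset /= ?lexx ?ltxx.
Qed.

Lemma covers_upset x y : covers x y -> minimal_in (upset x `\ x) y.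
Proof.
move=> [xy nxy]; split.
  by split; [exact: ltW|move=> /= yx; rewrite yx ltxx in xy].
move=> [z [xz /= /eqP zx] zy]; apply: nxy; exists z.
by rewrite zy andbT lt_neqAle eq_sym zx.
Qed.

Lemma minimal_setD1 (F : set P) x y :
  minimal_in F y -> y <> x -> minimal_in (F `\ x) y.
Proof.
by move=> [Fy My] yx; split=> // -[z [Fz _] zy]; apply: My; exists z.
Qed.

(** Whatever newly becomes minimal when x is removed was blocked by x alone, so
    nothing lies between it and x. *)
Lemma minimal_setD1E (F : set P) x y : is_filter F ->
  minimal_in F x -> minimal_in (F `\ x) y -> minimal_in F y \/ covers x y.
Proof.
move=> FF [Fx Mx] [[Fy /eqP yx] My].
have [xy|nxy] := boolP (x < y)%O; [right|left].
  split=> // -[z /andP[xz zy]]; apply: My; exists z => //; split.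
    exact: FF (ltW xz) Fx.
  by move=> /= zx; rewrite zx ltxx in xz.
split=> // -[z Fz zy]; apply: My; exists z => //; split => // /= zx.
by rewrite -zx zy in nxy.
Qed.

End PosetMinimal.

(** * Peeling operators *)

Section Peeling.
Context (d : Order.disp_t) (P : porderType d) (S : choiceType).

(** States in bijection, through U, with the filters of P, together with the
    removal of a minimal element. Away from minimal elements peel is
    unconstrained. *)
Record peeling (U : S -> set P) (peel : S -> P -> S) : Prop := Peeling {
  peel_filter : forall s, is_filter (U s);
  peel_inj : injective U;
  peel_surj : forall F, is_filter F -> exists s, U s = F;
  peelE : forall s x, minimal_in (U s) x -> U (peel s x) = U s `\ x }.

Context (K : numDomainType) (Gamma : finType) (adj : rel Gamma).
Context (kappa : P -> Gamma) (U : S -> set P) (peel : S -> P -> S).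
Implicit Types (x y z : P) (s t : S) (a b : Gamma).
Local Notation basis s := (<< s >> : {freeg S / K}).

Definition active a s : set P := [set x | kappa x = a /\ minimal_in (U s) x].

Definition peel_op a : {freeg S / K} -> {freeg S / K} :=
  fglift (fun s => \sum_(x \in active a s) basis (peel s x)).

HB.instance Definition _ a :=
  GRing.isLinear.Build K {freeg S / K} {freeg S / K} _ (peel_op a)
    (fglift_linear _).

Lemma peel_op_ket a s :
  peel_op a (basis s) = \sum_(x \in active a s) basis (peel s x).
Proof. exact: fglift_basis. Qed.

Lemma peel_op_inactive a s : active a s = set0 -> peel_op a (basis s) = 0.
Proof. by move=> A0; rewrite peel_op_ket A0 fsbig_set0. Qed.

Hypothesis Upeel : peeling U peel.

Section Singleton.
Hypothesis kappaEC : EC kappa.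

Lemma active_uniq a s x y : active a s x -> active a s y -> x = y.
Proof.
move=> [kx [Ux Mx]] [ky [Uy My]]; apply: contrapT => nxy.
have [|xy|yx] := kappaEC (x := x) (y := y); first by rewrite kx ky.
  by apply: My; exists x => //; rewrite lt_neqAle xy andbT; apply/eqP.
by apply: Mx; exists y => //; rewrite lt_neqAle yx andbT; apply/eqP/nesym.
Qed.

Lemma active_set1 a s x : active a s x -> active a s = [set x].
Proof.
by move=> Ax; apply/seteqP; split=> [y Ay|_ ->//]; exact: active_uniq Ay Ax.
Qed.

Lemma active_finite a s : finite_set (active a s).
Proof.
have [->//|/set0P[x /active_set1->]] := eqVneq (active a s) set0.
exact: finite_set1.
Qed.

Lemma peel_op_active a s x :
  active a s x -> peel_op a (basis s) = basis (peel s x).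
Proof. by move=> Ax; rewrite peel_op_ket (active_set1 Ax) fsbig_set1. Qed.

End Singleton.

Section Necessity.
Hypothesis adj_sym : symmetric adj.
Hypothesis fin : forall a s, finite_set (active a s).
Hypothesis X2 : square_nilpotent peel_op.
Hypothesis XX : rel_XX adj peel_op.

(** Coefficients of peeling operators are natural numbers, so in characteristic
    zero no cancellation can hide a pair of successive peelings. *)
Lemma square_zero_no_pair a s x y : active a s x -> ~ active a (peel s x) y.
Proof.
move=> Ax Ay; set t := peel (peel s x) y.
have activeF (s' : S) z : active a s' z -> z \in fset_set (active a s').
  by move=> Az; rewrite in_fset_set; [exact: mem_set|exact: fin].
have cX (s' t' : S) : coeff t' (peel_op a (basis s')) =
    \sum_(z <- fset_set (active a s')) (peel s' z == t')%:R.
  rewrite peel_op_ket fsbig_finite // raddf_sum.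
  by apply: eq_bigr => z _; rewrite /= coeffU mul1r.
have c_ge0 (s' t' : S) : 0 <= coeff t' (peel_op a (basis s')).
  by rewrite cX sumr_ge0.
have c_gt0 (s' : S) z : active a s' z ->
    0 < coeff (peel s' z) (peel_op a (basis s')).
  move=> /activeF Az; rewrite cX (big_fsetD1 z Az) /= eqxx.
  by rewrite ltr_pwDl // sumr_ge0.
have /(congr1 (coeff t)) := X2 a (basis s).
rewrite [peel_op a (basis s)]peel_op_ket fsbig_finite // !raddf_sum coeff0.
apply/eqP/lt0r_neq0; rewrite (big_fsetD1 x (activeF _ _ Ax)) /=.
by rewrite ltr_pwDl ?sumr_ge0 //; exact: c_gt0.
Qed.

(** Incomparable elements of equal color would both be minimal in the filter
    that they generate. *)
Lemma necessary_EC : EC kappa.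
Proof.
move=> x y kxy; apply: contrapT => /not_orP[/negP nxy /negP nyx].
have [|s Us] := peel_surj Upeel (F := [set z | (x <= z)%O || (y <= z)%O]).
  by move=> u v uv /orP[h|h]; apply/orP; [left|right]; exact: le_trans h uv.
have Mx : minimal_in (U s) x.
  rewrite Us; split=> [|[z /= /orP[xz zx|yz /ltW/(le_trans yz) yx]]] /=.
  - by rewrite lexx.
  - by have := le_lt_trans xz zx; rewrite ltxx.
  - by rewrite yx in nyx.
have My : minimal_in (U s) y.
  rewrite Us; split=> [|[z /= /orP[xz /ltW/(le_trans xz) xy|yz zy]]] /=.
  - by rewrite lexx orbT.
  - by rewrite xy in nxy.
  - by have := le_lt_trans yz zy; rewrite ltxx.
apply: (@square_zero_no_pair (kappa x) s x y) => //; split=> //.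
rewrite (peelE Upeel Mx); apply: minimal_setD1 => // yx.
by rewrite yx lexx in nyx.
Qed.

Lemma active_upset x : exists2 s, U s = upset x & active (kappa x) s x.
Proof.
have [s Us] := peel_surj Upeel (@upset_filter _ _ x).
by exists s => //; split=> //; rewrite Us; exact: minimal_upset.
Qed.

Lemma active_covers s x y : U s = upset x -> covers x y ->
  active (kappa y) (peel s x) y.
Proof.
move=> Us xy; split=> //; rewrite (peelE Upeel) Us; first exact: covers_upset.
exact: minimal_upset.
Qed.

(** Otherwise the colors of x and y either agree, and x and y form a forbidden
    pair, or are distant, and the operators of these colors do not commute on
    the principal filter of x. *)
Lemma covers_adj x y : covers x y -> adj (kappa x) (kappa y).
Proof.
move=> xy; have [s Us Ax] := active_upset x.
have Ay := active_covers Us xy.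
apply: contrapT => /negP nadj.
have nk : kappa x <> kappa y.
  by move=> kxy; move: Ay; rewrite -kxy; exact: square_zero_no_pair.
have dist : distant adj (kappa x) (kappa y).
  by rewrite /distant nadj andbT; apply/eqP.
have := XX.1 _ _ dist (basis s); rewrite /commutator.
rewrite (peel_op_active necessary_EC Ax) (peel_op_active necessary_EC Ay).
rewrite (peel_op_inactive (a := kappa y) (s := s)) ?linear0 ?addr0.
  by move/eqP; rewrite freegU_eq0 oner_eq0.
(* The filter generated by x has no minimal element besides x. *)
rewrite -subset0 => z [kz []]; rewrite Us => xz Mz; apply: Mz.
exists x; first exact: lexx.
by rewrite lt_neqAle xz andbT; apply/eqP => xz'; apply: nk; rewrite xz' kz.
Qed.

Lemma necessary_NA : NA adj kappa.
Proof. by move=> x y [/covers_adj//|/covers_adj]; rewrite adj_sym. Qed.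

Lemma necessary_I3ND : I3ND kappa.
Proof.
move=> x y z xy yz xz kxz; have [s Us Ax] := active_upset x.
have Ay := active_covers Us xy.
have Az : active (kappa x) (peel (peel s x) y) z.
  have Us' : U (peel (peel s x) y) = upset x `\ x `\ y.
    by rewrite (peelE Upeel Ay.2) (peelE Upeel Ax.2) Us.
  have xltz : (x < z)%O by exact: lt_trans xy.1 yz.1.
  split; rewrite // Us'; split.
    split; first split; first exact: ltW.
      by move=> /= zx; rewrite zx ltxx in xltz.
    by move=> /= zy; have := yz.1; rewrite zy ltxx.
  move=> [w [[xw /= wx] /= wy] wz].
  have : [set w | (x <= w <= z)%O] w by rewrite /= (ltW wz) andbT.
  by rewrite xz => -[[]|] //= wz'; rewrite wz' ltxx in wz.
(* Modulo squares, the double bracket is minus twice X_a X_b X_a. *)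
have := XX.2 (kappa x) (kappa y) (basis s); rewrite /commutator.
rewrite linearB /= X2 sub0r X2 linear0 subr0.
rewrite (peel_op_active necessary_EC Ax) (peel_op_active necessary_EC Ay).
rewrite (peel_op_active necessary_EC Az).
move=> /(congr1 (coeff (peel (peel (peel s x) y) z))).
rewrite coeffB coeffN coeffU eqxx mulr1 coeff0 => /eqP.
by rewrite -opprD oppr_eq0 -mulr2n pnatr_eq0.
Qed.

End Necessity.

Section Sufficiency.
Hypothesis adj_sym : symmetric adj.
Hypothesis adj_irrefl : irreflexive adj.
Hypothesis kappaEC : EC kappa.
Hypothesis kappaNA : NA adj kappa.
Hypothesis kappaI3ND : I3ND kappa.

Lemma active_peel_distant a b s x y : ~~ adj a b -> active a s x ->
  active b (peel s x) y -> active b s y.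
Proof.
move=> nadj [kx Mx] [ky]; rewrite (peelE Upeel Mx) => My.
have [//|xy] := minimal_setD1E (peel_filter Upeel (s := s)) Mx My.
by have := kappaNA (or_introl xy); rewrite kx ky (negbTE nadj).
Qed.

Lemma active_peel_same a s x y : active a s x -> ~ active a (peel s x) y.
Proof.
move=> Ax Ay.
have Ay' : active a s y by apply: active_peel_distant Ax Ay; rewrite adj_irrefl.
case: Ay => _; rewrite (peelE Upeel Ax.2) (active_uniq kappaEC Ay' Ax).
by case=> -[_ nxx] _; apply: nxx.
Qed.

Lemma active_peel_neq a b s x y : a != b -> active a s x -> active b s y ->
  active b (peel s x) y.
Proof.
move=> ab [kx Mx] [ky My]; split=> //; rewrite (peelE Upeel Mx).
apply: minimal_setD1 => // yx; move/eqP: ab; apply.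
by rewrite -kx -ky yx.
Qed.

Lemma sufficient_square : square_nilpotent peel_op.
Proof.
move=> a; apply: (eq_on_basis (f := peel_op a \o peel_op a) (g := \0)) => s /=.
have [A0|/set0P[x Ax]] := eqVneq (active a s) set0.
  by rewrite (peel_op_inactive A0) !linear0.
rewrite (peel_op_active kappaEC Ax) peel_op_inactive // -subset0 => y.
exact: active_peel_same.
Qed.

Lemma peel_op_distant0 a b s : distant adj a b ->
  active b s = set0 -> peel_op b (peel_op a (basis s)) = 0.
Proof.
move=> /andP[_ nadj] B0.
have [A0|/set0P[x Ax]] := eqVneq (active a s) set0.
  by rewrite (peel_op_inactive A0) !linear0.
rewrite (peel_op_active kappaEC Ax) peel_op_inactive // -subset0 => y Ay.
by rewrite -B0; exact: active_peel_distant Ax Ay.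
Qed.

Lemma sufficient_distant a b : distant adj a b ->
  commutator (peel_op b) (peel_op a) =1 fun=> 0.
Proof.
move=> dab v; apply/eqP; rewrite /commutator subr_eq0; apply/eqP; move: v.
have dba : distant adj b a by rewrite /distant eq_sym adj_sym.
apply: (eq_on_basis (f := peel_op b \o peel_op a) (g := peel_op a \o peel_op b)).
move=> s /=.
have [A0|/set0P[x Ax]] := eqVneq (active a s) set0.
  by rewrite [RHS]peel_op_distant0 // (peel_op_inactive A0) linear0.
have [B0|/set0P[y Ay]] := eqVneq (active b s) set0.
  by rewrite [LHS]peel_op_distant0 // (peel_op_inactive B0) linear0.
have [ab _] := andP dab; have ba : b != a by rewrite eq_sym.
have Ay' := active_peel_neq ab Ax Ay; have Ax' := active_peel_neq ba Ay Ax.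
rewrite !(peel_op_active kappaEC Ax, peel_op_active kappaEC Ay).
rewrite !(peel_op_active kappaEC Ax', peel_op_active kappaEC Ay').
congr << _ >>; apply: (peel_inj Upeel).
rewrite (peelE Upeel Ax'.2) (peelE Upeel Ay'.2).
rewrite (peelE Upeel Ax.2) (peelE Upeel Ay.2).
by rewrite !setDDl setUC.
Qed.

(** Since z is minimal once x and y are gone, and lies above x by EC, the interval
    [x, z] is contained in {x, y, z}. It is not {x, z}, as neighbors have adjacent, hence
    different, colors. So it is a three-element chain, which I3ND excludes. *)
Lemma active_sandwich a b s x y z : active a s x -> active b (peel s x) y ->
  ~ active a (peel (peel s x) y) z.
Proof.
move=> [kx Mx] [ky My] [kz Mz].
rewrite (peelE Upeel My) (peelE Upeel Mx) in Mz.
rewrite (peelE Upeel Mx) in My.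
have [[[Uz /eqP zx] zy] Nz] := Mz.
have xz : (x < z)%O.
  rewrite lt_neqAle eq_sym zx /=.
  have [|//|zx'] := kappaEC (x := x) (y := z); first by rewrite kx kz.
  by case: Mx => _ []; exists z => //; rewrite lt_neqAle zx.
have itv w : (x <= w)%O -> (w <= z)%O -> [\/ w = x, w = y | w = z].
  move=> xw wz; have [->|wx] := pselect (w = x); first exact: Or31.
  have [->|wy] := pselect (w = y); first exact: Or32.
  have [->|wz'] := eqVneq w z; first exact: Or33.
  case: Nz; exists w; last by rewrite lt_neqAle wz'.
  by do 2![split=> //]; exact: peel_filter Upeel _ _ _ xw Mx.1.
have [/andP[xy yz]|nxyz] := boolP (x < y < z)%O; last first.
  have /kappaNA : neighbors x z; last by rewrite kx kz adj_irrefl.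
  left; split=> // -[w /andP[xw wz]].
  case: (itv w (ltW xw) (ltW wz)) => we; rewrite we ?ltxx // in xw wz.
  by rewrite xw wz in nxyz.
suff : kappa x <> kappa z by rewrite kx kz.
apply: (kappaI3ND (y := y)).
- split=> // -[w /andP[xw wy]]; have wz := lt_trans wy yz.
  case: (itv w (ltW xw) (ltW wz)) => we; rewrite we ?ltxx // in xw wy wz.
- split=> // -[w /andP[yw wz]]; have xw := lt_trans xy yw.
  case: (itv w (ltW xw) (ltW wz)) => we; rewrite we ?ltxx // in xw yw wz.
- apply/seteqP; split=> w /=.
    by move=> /andP[xw wz]; case: (itv w xw wz) => ->;
      [left; left|left; right|right].
  by move=> [[->|->]|->]; rewrite ?lexx ?(ltW xz) ?(ltW xy) ?(ltW yz).
Qed.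

Lemma sufficient_serre a b v : peel_op a (peel_op b (peel_op a v)) = 0.
Proof.
apply: (eq_on_basis (f := peel_op a \o (peel_op b \o peel_op a)) (g := \0)).
move=> {v} s /=.
have [A0|/set0P[x Ax]] := eqVneq (active a s) set0.
  by rewrite (peel_op_inactive A0) !linear0.
rewrite (peel_op_active kappaEC Ax).
have [A0|/set0P[y Ay]] := eqVneq (active b (peel s x)) set0.
  by rewrite (peel_op_inactive A0) linear0.
rewrite (peel_op_active kappaEC Ay) peel_op_inactive // -subset0 => z.
exact: active_sandwich Ax Ay.
Qed.

Lemma sufficient_XX : rel_XX adj peel_op.
Proof.
split=> [a b|a b v]; first exact: sufficient_distant.
rewrite /commutator linearB /=.
by rewrite !(sufficient_square, sufficient_serre, linear0, addr0).
Qed.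

End Sufficiency.

Theorem peel_rep_coloring : symmetric adj -> irreflexive adj ->
  [/\ forall a s, finite_set (active a s), rel_XX adj peel_op
    & square_nilpotent peel_op]
  <-> [/\ EC kappa, NA adj kappa & I3ND kappa].
Proof.
move=> adj_sym adj_irr; split=> [[fin XX X2]|[ec na i3]].
  split; first exact: necessary_EC.
    exact: necessary_NA.
  exact: necessary_I3ND.
split; first exact: active_finite.
  exact: sufficient_XX.
exact: sufficient_square.
Qed.

(** On a basis vector, the commutator with a diagonal operator multiplies the
    unique peeled term by the jump of the eigenvalue along that step. *)
Lemma diagonal_commutatorP (h : {linear {freeg S / K} -> {freeg S / K}})
    (eta : S -> K) (c : Gamma -> K) : EC kappa ->
  (forall s, h (basis s) = eta s *: basis s) ->
  (forall a v, commutator h (peel_op a) v = c a *: peel_op a v) <->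
  (forall s x, minimal_in (U s) x -> eta (peel s x) - eta s = c (kappa x)).
Proof.
move=> ec hE.
have comm_active a s x : active a s x ->
    commutator h (peel_op a) (basis s) =
    (eta (peel s x) - eta s) *: basis (peel s x).
  move=> Ax; rewrite /commutator hE linearZ /= (peel_op_active ec Ax) hE.
  by rewrite -scalerBl.
split=> [HX s x Mx|Heta a v].
  have Ax : active (kappa x) s x by [].
  move: (HX (kappa x) (basis s)).
  rewrite (comm_active _ _ _ Ax) (peel_op_active ec Ax).
  move/(congr1 (coeff (peel s x))).
  by rewrite !coeff_fgscale coeffU eqxx !mulr1.
rewrite /commutator; apply/eqP; rewrite subr_eq; apply/eqP; move: v.
apply: (eq_on_basis (f := h \o peel_op a)
  (g := (c a \*: peel_op a) \+ (peel_op a \o h))) => s /=.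
apply/eqP; rewrite -subr_eq; apply/eqP.
rewrite -/(commutator h (peel_op a) (basis s)).
have [A0|/set0P[x Ax]] := eqVneq (active a s) set0; last first.
  by rewrite (comm_active _ _ _ Ax) (peel_op_active ec Ax) (Heta _ _ Ax.2) Ax.1.
by rewrite /commutator hE linearZ /= peel_op_inactive // !(scaler0, linear0, addr0).
Qed.

(** Each class of filters modulo finite differences gets a reference filter
    (base s), shared by s and peel s x; eta is the signed sum of w over the
    difference with it. Whether or not x lies in the reference filter, removing
    x changes this sum by w x. *)
Lemma potential_exists (w : P -> K) : exists eta : S -> K,
  forall s x, minimal_in (U s) x -> eta (peel s x) - eta s = w x.
Proof.
have [s0 _] := peel_surj Upeel (F := setT) (fun _ _ _ _ => I).
pose near s t := finite_set (U s `\` U t) /\ finite_set (U t `\` U s).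
pose base s := xget s0 [set t | near s t].
have near_base s : near s (base s).
  by apply: (@xgetPex _ s0 [set t | near s t]); exists s; split; rewrite setDv.
have near_sym s t : near s t -> near t s by case.
have sub3 A B C : finite_set (A `\` B) -> finite_set (B `\` C) ->
    finite_set (A `\` C : set P).
  move=> fAB fBC; apply: (sub_finite_set (B := (A `\` B) `|` (B `\` C))).
    by move=> u [Au Cu]; have [Bu|Bu] := pselect (B u); [right|left].
  by rewrite finite_setU.
have near_trans s t u : near s t -> near t u -> near s u.
  move=> [st ts] [tu ut]; split; [exact: sub3 st tu|exact: sub3 ut ts].
have base_eq s t : near s t -> base s = base t.
  move=> st; congr xget; apply/seteqP; split=> u.
    exact: near_trans (near_sym _ _ st).
  exact: near_trans st.
exists (fun s => \sum_(x \in U (base s) `\` U s) w x -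
                 \sum_(x \in U s `\` U (base s)) w x) => s x Mx.
have Up := peelE Upeel Mx.
have Dp : U s `\` U (peel s x) = [set x].
  rewrite Up; apply/seteqP; split=> [u [Uu /not_andP[//|/contrapT//]]|_ ->].
  by split; [exact: Mx.1|case=> _; apply].
have <- : base s = base (peel s x).
  apply: base_eq; split; first by rewrite Dp; exact: finite_set1.
  by rewrite Up (_ : _ `\` _ = set0) //; apply/seteqP; split=> // u [[]].
have [f1 f2] := near_base s; rewrite {}Up.
set B := U (base s) in f1 f2 *.
have [Bx|Bx] := pselect (B x).
  have -> : (U s `\ x) `\` B = U s `\` B.
    apply/seteqP; split=> u [Uu nBu]; split=> //; first by case: Uu.
    by split=> // ux; apply: nBu; rewrite ux.
  have <- : (B `\` (U s `\ x)) `\ x = B `\` U s.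
    apply/seteqP; split=> [u [[Bu nu] ux]|u [Bu nu]].
      by split=> // Uu; apply: nu.
    by split; [split=> // -[]|move=> ux; apply: nu; rewrite ux; exact: Mx.1].
  rewrite (fsbigD1 x) /=; last by split=> // -[_]; apply.
    by rewrite opprB addrA subrK addrK.
  apply: (sub_finite_set (B := (B `\` U s) `|` [set x])).
    move=> u [Bu nu]; have [->|ux] := pselect (u = x); first by right.
    by left; split=> // Uu; apply: nu.
  by rewrite finite_setU.
have -> : B `\` (U s `\ x) = B `\` U s.
  apply/seteqP; split=> u [Bu nu]; split=> //; last by case.
  by move=> Uu; apply: nu; split=> // ux; apply: Bx; rewrite -ux.
have -> : (U s `\ x) `\` B = (U s `\` B) `\ x.
  by apply/seteqP; split=> u [[]].
rewrite (@fsbigD1 _ _ _ _ x (U s `\` B)) //=; last by split; [exact: Mx.1|].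
by rewrite opprB [w x + _]addrC !addrA subrK addrAC subrr add0r.
Qed.

End Peeling.

(** * Splits as states of two opposite peelings *)

Section Duality.
Context (d : Order.disp_t) (P : porderType d).

Lemma ideal_compl (s : split P) : ideal s = ~` filt s.
Proof. by have /asboolP[] := splitP s. Qed.

Lemma filt_filter (s : split P) : is_filter (filt s).
Proof. by have /asboolP[] := splitP s. Qed.

Lemma filt_inj : injective (@filt d P).
Proof.
move=> s t st; apply: val_inj => /=.
have := ideal_compl t; rewrite -st -ideal_compl /ideal.
by move: st; rewrite /filt; case: (s : _ * _) (t : _ * _) => ? ? [? ?] /= -> ->.
Qed.

Lemma filt_surj (F : set P) : is_filter F -> exists s, filt s = F.
Proof.
move=> FF; have Fs : is_split (F, ~` F) by apply/asboolP.
by exists (Split Fs).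
Qed.

Lemma peeling_filt : peeling (@filt d P) (@to_ideal d P).
Proof.
split=> [|||s x Mx]; [exact: filt_filter|exact: filt_inj|exact: filt_surj|].
by rewrite [LHS]/filt to_idealE.
Qed.

(** An ideal is a filter of the opposite poset, and its maximal elements are
    minimal there. *)
Lemma peeling_ideal : @peeling _ P^d _ (@ideal d P) (@to_filt d P).
Proof.
split=> [s x y yx|s t st|F FF|s y My].
- by rewrite ideal_compl => Fx Fy; apply: Fx; exact: filt_filter yx Fy.
- by apply: filt_inj; apply: setC_inj; rewrite -!ideal_compl.
- have [|s sF] := @filt_surj (~` F); last first.
    by exists s; rewrite ideal_compl sF setCK.
  by move=> x y xy Fx Fy; apply: Fx; exact: FF _ _ xy Fy.
- by rewrite [LHS]/ideal to_filtE.
Qed.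

Lemma to_idealK (s : split P) x : minimal_in (filt s) x ->
  maximal_in (ideal (to_ideal s x)) x /\ to_filt (to_ideal s x) x = s.
Proof.
move=> Mx; have [Fx Nx] := Mx.
have Mx' : maximal_in (ideal (to_ideal s x)) x.
  rewrite /ideal to_idealE //; split=> [|[y /= [Iy|->]]]; rewrite ?ltxx //.
    by right.
  move: Iy; rewrite ideal_compl => Fy xy; apply: Fy.
  exact: filt_filter (ltW xy) Fx.
split=> //; apply: filt_inj; rewrite {1}/filt to_filtE //= /filt to_idealE //=.
apply/seteqP; split=> [y [[]|->]//|y Fy].
by have [->|] := pselect (y = x); [right|left].
Qed.

Context (Gamma : finType) (adj : rel Gamma) (kappa : P -> Gamma).

Lemma covers_dual (x y : P) : @covers _ P^d x y <-> covers y x.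
Proof.
split=> -[yx nyx]; (split; first exact yx) => -[z]; rewrite ?ltEdual andbC => yz.
  by apply: nyx; exists z; rewrite !ltEdual.
by apply: nyx; exists z.
Qed.

Lemma neighbors_dual (x y : P) : @neighbors _ P^d x y <-> neighbors x y.
Proof. by rewrite /neighbors !covers_dual or_comm. Qed.

Lemma EC_dual : @EC Gamma _ P^d kappa <-> EC kappa.
Proof. by split=> ec x y /esym/ec[]; [left|right|left|right]. Qed.

Lemma NA_dual : @NA Gamma adj _ P^d kappa <-> NA adj kappa.
Proof. by split=> na x y nxy; apply: na; apply/neighbors_dual. Qed.

Lemma I3ND_dual : @I3ND Gamma _ P^d kappa <-> I3ND kappa.
Proof.
have itv (x z : P) :
    [set w : P | ((x : P^d) <= (w : P^d) <= (z : P^d))%O] =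
    [set w | (z <= w <= x)%O].
  by apply/funext => w; rewrite /= !leEdual andbC.
have rev3 (x y z : P) : [set z; y; x] = [set x; y; z].
  by rewrite setUC setUA setUAC.
split=> i3 x y z /covers_dual xy /covers_dual yz xz /esym;
  apply: (i3 z y x yz xy).
  by rewrite itv xz rev3.
by rewrite -itv xz rev3.
Qed.

Lemma coloring_dual :
  [/\ @EC Gamma _ P^d kappa, @NA Gamma adj _ P^d kappa
    & @I3ND Gamma _ P^d kappa] <-> [/\ EC kappa, NA adj kappa & I3ND kappa].
Proof.
by split=> -[/EC_dual ec /NA_dual na /I3ND_dual i3].
Qed.

End Duality.

(** * Representations on the lattice of splits *)

Section Lattice.
Context (R : realType) (Gamma : finType) (adj : rel Gamma).
Hypothesis adj_sym : symmetric adj.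
Hypothesis adj_irrefl : irreflexive adj.
Context (d : Order.disp_t) (P : porderType d) (kappa : P -> Gamma).
Local Notation V := (FIspace R P).

Local Notation coloring := [/\ EC kappa, NA adj kappa & I3ND kappa].

Lemma n_plusP :
  rep_n_plus R adj kappa /\ square_nilpotent (Xop R kappa) <-> coloring.
Proof.
rewrite -(peel_rep_coloring R[i] kappa (peeling_filt P) adj_sym adj_irrefl).
by split=> [[[? ?] ?]|[? ? ?]].
Qed.

Lemma n_minusP :
  rep_n_minus R adj kappa /\ square_nilpotent (Yop R kappa) <-> coloring.
Proof.
rewrite -coloring_dual -(@peel_rep_coloring _ P^d _ R[i] _ _ kappa _ _
  (peeling_ideal P) adj_sym adj_irrefl).
by split=> [[[? ?] ?]|[? ? ?]].
Qed.

Definition diag_op (eta : split P -> R[i]) : V -> V :=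
  fglift (fun s => eta s *: ket R s).

HB.instance Definition _ eta :=
  GRing.isLinear.Build R[i] V V _ (diag_op eta) (fglift_linear _).

Lemma diag_op_ket eta s : diag_op eta (ket R s) = eta s *: ket R s.
Proof. exact: fglift_basis. Qed.

Lemma diag_op_commute eta eta' :
  commutator (diag_op eta) (diag_op eta') =1 fun=> 0.
Proof.
move=> v; apply/eqP; rewrite /commutator subr_eq0; apply/eqP; move: v.
apply: (eq_on_basis (f := diag_op eta \o diag_op eta')
                    (g := diag_op eta' \o diag_op eta)) => s /=.
rewrite -/(ket R s) !diag_op_ket !linearZ /= !diag_op_ket.
by rewrite !scalerA mulrC.
Qed.

Lemma b_plus_exists : coloring ->
  exists H : Gamma -> {linear V -> V}, rep_b_plus adj kappa H.
Proof.
move=> col; have [[fin XX] _] := n_plusP.2 col; case: col => ec _ _.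
have /choice[eta etaP] b := potential_exists (peeling_filt P)
  (fun x => (theta adj (kappa x) b)%:~R : R[i]).
exists (fun b => diag_op (eta b)); split=> //.
- by exists eta => b s; exact: diag_op_ket.
- by move=> a b; exact: diag_op_commute.
- move=> a b.
  have := diagonal_commutatorP (h := diag_op (eta b)) (@filt d P) (@to_ideal d P)
    (fun a => (theta adj a b)%:~R) ec (diag_op_ket (eta b)).
  by move=> [_ /(_ (etaP b))]; exact.
Qed.

Lemma b_minus_exists : coloring ->
  exists H : Gamma -> {linear V -> V}, rep_b_minus adj kappa H.
Proof.
move=> col; have [[fin YY] _] := n_minusP.2 col; case: col => /EC_dual ec _ _.
have /choice[eta etaP] b := potential_exists (peeling_ideal P)
  (fun x => - (theta adj (kappa x) b)%:~R : R[i]).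
exists (fun b => diag_op (eta b)); split=> //.
- by exists eta => b s; exact: diag_op_ket.
- by move=> a b; exact: diag_op_commute.
- move=> a b.
  have := diagonal_commutatorP (P := P^d) (h := diag_op (eta b)) (@ideal d P)
    (@to_filt d P) (fun a => - (theta adj a b)%:~R) ec (diag_op_ket (eta b)).
  by move=> [_ /(_ (etaP b))]; exact.
Qed.

Lemma b_plus_edge_diagonal (H : Gamma -> {linear V -> V}) :
  coloring -> rep_b_plus adj kappa H -> edge_diagonal adj kappa H.
Proof.
move=> [ec _ _] [_ [eta etaP] _ _ HX]; exists eta => // b.
have [+ _] := diagonal_commutatorP (@filt d P) (@to_ideal d P)
  (fun a => (theta adj a b)%:~R) ec (etaP b).
by apply=> a; exact: HX.
Qed.

(** Here the eigenvalue jumps are known along steps that shrink the ideal; every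
    step that grows it is the reverse of one of these ([to_idealK]). *)
Lemma b_minus_edge_diagonal (H : Gamma -> {linear V -> V}) :
  coloring -> rep_b_minus adj kappa H -> edge_diagonal adj kappa H.
Proof.
move=> [/EC_dual ec _ _] [_ [eta etaP] _ _ HY]; exists eta => // b s x Mx.
have [My sE] := to_idealK Mx.
have [jump _] := diagonal_commutatorP (P := P^d) (@ideal d P) (@to_filt d P)
  (fun a => - (theta adj a b)%:~R) ec (etaP b).
have := jump (fun a => HY a b) _ _ My.
by rewrite sE => h; rewrite -[RHS]opprK -h opprB.
Qed.

End Lattice.

Theorem theorem6p12 (R : realType) (Gamma : finType) (adj : rel Gamma)
  (adj_sym : symmetric adj) (adj_irrefl : irreflexive adj)
  (d : Order.disp_t) (P : porderType d) (P_lf : locally_finite P)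
  (kappa : P -> Gamma) (kappa_surj : forall a : Gamma, exists x : P, kappa x = a) :
  [<-> (* (i) *)
       rep_n_plus R adj kappa /\ square_nilpotent (Xop R kappa);
       (* (ii) *)
       (exists H : Gamma -> {linear FIspace R P -> FIspace R P},
          rep_b_plus adj kappa H) /\ square_nilpotent (Xop R kappa);
       (* (iii) *)
       [/\ EC kappa, NA adj kappa & I3ND kappa];
       (* (iv) *)
       (exists H : Gamma -> {linear FIspace R P -> FIspace R P},
          rep_b_minus adj kappa H) /\ square_nilpotent (Yop R kappa);
       (* (v) *)
       rep_n_minus R adj kappa /\ square_nilpotent (Yop R kappa)] /\
  (forall H : Gamma -> {linear FIspace R P -> FIspace R P},
     rep_b_plus adj kappa H -> square_nilpotent (Xop R kappa) ->
     edge_diagonal adj kappa H) /\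
  (forall H : Gamma -> {linear FIspace R P -> FIspace R P},
     rep_b_minus adj kappa H -> square_nilpotent (Yop R kappa) ->
     edge_diagonal adj kappa H).
Proof.
have colX := n_plusP R adj_sym adj_irrefl kappa.
have colY := n_minusP R adj_sym adj_irrefl kappa.
have bX H : rep_b_plus (R := R) adj kappa H -> rep_n_plus R adj kappa by case.
have bY H : rep_b_minus (R := R) adj kappa H -> rep_n_minus R adj kappa by case.
split; [tfae|split].
- move=> /[dup] /colX/(b_plus_exists R adj_sym adj_irrefl) H [_ X2].
  by split.
- by move=> [[H /bX nX] X2]; apply/colX.
- move=> col; split; last exact: (colY.2 col).2.
  exact: b_minus_exists.
- by move=> [[H /bY nY] Y2]; split.
- by move=> /colY/colX.
- move=> H HX X2; apply: b_plus_edge_diagonal (HX) => //.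
  by apply/colX; split=> //; exact: bX HX.
- move=> H HY Y2; apply: b_minus_edge_diagonal (HY) => //.
  by apply/colY; split=> //; exact: bY HY.
Qed.
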